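(* Let $\mathcal{C}(\xi)$ be a NURBS curve defined over the parameter $\xi$ within the domain of the knot vector $\Xi$. Let $s,t\in\mathbb{R}$ with $s>0$, let $\hat{\Xi}=s\,\Xi+t$ be the scaled and translated knot vector, and let $\hat{\mathcal{C}}$ be the NURBS curve over $\hat{\Xi}$ with the same degree, control points and weights as $\mathcal{C}$. Then $\hat{\mathcal{C}}(s\xi+t)=\mathcal{C}(\xi)$ for all $\xi$ in the parameter domain of $\mathcal{C}$; that is, the geometric shape of the curve is invariant under scaling and translation of its parameter domain.
   Context: A knot vector $\Xi=(\xi_0,\dots,\xi_{n+p+1})$ is a nondecreasing finite sequence of real numbers; $s\,\Xi+t$ denotes $(s\xi_0+t,\dots,s\xi_{n+p+1}+t)$. The B-spline basis functions over $\Xi$ are defined recursively: $N^{\Xi}_{i,0}(\xi)=1$ if $\xi_i\le \xi<\xi_{i+1}$ and $0$ otherwise; for $p\ge 1$, $$N^{\Xi}_{i,p}(\xi)=\frac{\xi-\xi_i}{\xi_{i+p}-\xi_i}N^{\Xi}_{i,p-1}(\xi)+\frac{\xi_{i+p+1}-\xi}{\xi_{i+p+1}-\xi_{i+1}}N^{\Xi}_{i+1,p-1}(\xi),$$ where any term whose denominator is zero is taken to be $0$. Given control points $\mathbf{P}_0,\dots,\mathbf{P}_n\in\mathbb{R}^2$ and real weights $\omega_0,\dots,\omega_n$, the degree-$p$ NURBS curve over $\Xi$ is $$\mathcal{C}(\xi)=\sum_{i=0}^{n}\mathbf{P}_i\,R^{\Xi}_{i,p}(\xi),\qquad R^{\Xi}_{i,p}(\xi)=\frac{\omega_i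 N^{\Xi}_{i,p}(\xi)}{\sum_{j=0}^{n}\omega_j N^{\Xi}_{j,p}(\xi)},$$ for parameters $\xi$ at which the denominator is nonzero. *)

(* Defs.v *)
From mathcomp Require Import all_boot all_order all_algebra.
From mathcomp Require Import classical_sets reals.

Set Implicit Arguments.
Unset Strict Implicit.
Unset Printing Implicit Defensive.

Import Order.TTheory GRing.Theory Num.Theory.

Local Open Scope classical_set_scope.
Local Open Scope ring_scope.

Section Nurbs.
Variable R : realType.

Definition knot_vector (n p : nat) (Xi : (n + p).+2.-tuple R) : Prop :=
  sorted <=%R Xi.

Definition affine_knots (n p : nat) (s t : R) (Xi : (n + p).+2.-tuple R) :
    (n + p).+2.-tuple R :=
  [tuple of map (fun xi => s * xi + t) Xi].

(* [bspline Xi p i] is N_{i,p} over the knots [Xi]. Since [0^-1 = 0], a term  *)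
(* whose denominator vanishes is 0, as the recursion requires. For i <= n,    *)
(* only the knots of index at most i + p + 1 <= n + p + 1 are read, so the    *)
(* default value of [nth] plays no role.                                      *)
Fixpoint bspline (Xi : seq R) (p i : nat) (x : R) : R :=
  match p with
  | 0%N => if Xi`_i <= x < Xi`_(i + 1) then 1 else 0
  | q.+1 =>
      (x - Xi`_i) / (Xi`_(i + p) - Xi`_i) * bspline Xi q i x
      + (Xi`_(i + p + 1) - x) / (Xi`_(i + p + 1) - Xi`_(i + 1))
        * bspline Xi q (i + 1) x
  end.

Section Curve.
Variables (n p : nat) (Xi : (n + p).+2.-tuple R).
Variables (P : 'I_n.+1 -> 'rV[R]_2) (w : 'I_n.+1 -> R).

Definition nurbs_denom (x : R) : R := \sum_(j < n.+1) w j * bspline Xi p j x.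

Definition nurbs_basis (i : 'I_n.+1) (x : R) : R :=
  w i * bspline Xi p i x / nurbs_denom x.

(* Meaningful only on [nurbs_domain], since division is total.                *)
Definition nurbs_curve (x : R) : 'rV[R]_2 :=
  \sum_(i < n.+1) nurbs_basis i x *: P i.

Definition nurbs_domain : set R :=
  [set x | Xi`_0 <= x <= Xi`_(n + p + 1) /\ nurbs_denom x != 0].

Definition nurbs_shape : set 'rV[R]_2 := nurbs_curve @` nurbs_domain.

End Curve.
End Nurbs.

(* Main.v *)
Require Import Defs.
From mathcomp Require Import all_boot all_order all_algebra.
From mathcomp Require Import classical_sets reals.

Set Implicit Arguments.
Unset Strict Implicit.
Unset Printing Implicit Defensive.

Import Order.TTheory GRing.Theory Num.Theory.

Local Open Scope classical_set_scope.
Local Open Scope ring_scope.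

(** The Cox-de Boor recursion sees the parameter and the knots only through
    comparisons and through quotients of differences. The map sending [x] to
    [s * x + t] with [0 < s] preserves both: it is increasing, and it multiplies
    every difference by [s], which cancels in each quotient. Hence every basis
    function takes the same value at corresponding parameters
    ([bspline_affine]), and so do the common denominator of the rational basis
    and the curve itself. The parameter domains correspond in the same way
    ([nurbs_domain_affine]); since the change of parameter is a bijection of the
    line, the two curves also have the same image. *)

(** The division is total: when [a = b] both sides are divisions by zero, so the
    identity covers the terms that the recursion discards. *)
Lemma affine_ratio (R : realType) (s t x y a b : R) : s != 0 ->
  (s * x + t - (s * y + t)) / (s * b + t - (s * a + t)) = (x - y) / (b - a).
Proof.
move=> s0; have subE u v : s * u + t - (s * v + t) = s * (u - v).
  by rewrite opprD addrACA subrr addr0 mulrBr.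
rewrite !subE.
by rewrite -mulf_div divff // mul1r.
Qed.

Lemma ler_affine (R : realType) (s t : R) : 0 < s ->
  {mono (fun x : R => s * x + t) : x y / x <= y}.
Proof. by move=> s_gt0 x y; rewrite lerD2r ler_pM2l. Qed.

(** The bound on [i] keeps every index read by the recursion inside the knot
    sequence: past its end the default knot is [0] on both sides, and [0] is not
    sent to [0] unless [t = 0]. *)
Lemma bspline_affine (R : realType) (s t : R) (Xi : seq R) (p i : nat) (x : R) :
  0 < s -> (i + p + 1 < size Xi)%N ->
  bspline [seq s * xi + t | xi <- Xi] p i (s * x + t) = bspline Xi p i x.
Proof.
move=> s_gt0; have s0 : s != 0 by rewrite gt_eqF.
have nthE k : (k < size Xi)%N -> [seq s * xi + t | xi <- Xi]`_k = s * Xi`_k + t.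
  by move=> ltk; rewrite (nth_map 0).
elim: p i => [|p IHp] i lti /=.
  rewrite addn0 in lti; rewrite !nthE //; last first.
    by apply: leq_ltn_trans lti; rewrite leq_addr.
  by rewrite ler_affine // ltrD2r ltr_pM2l.
have ltp : (i + p.+1 < size Xi)%N.
  by apply: leq_ltn_trans lti; rewrite leq_addr.
have lt1 : (i + 1 < size Xi)%N by apply: leq_ltn_trans ltp; rewrite leq_add2l.
have lt0 : (i < size Xi)%N by apply: leq_ltn_trans lt1; rewrite leq_addr.
have ltl : (i + p + 1 < size Xi)%N by rewrite -addnA addn1.
have ltr : (i + 1 + p + 1 < size Xi)%N by rewrite -(addnA i) add1n.
by rewrite !nthE // !affine_ratio // !IHp.
Qed.

Section AffineReparametrization.
Variables (R : realType) (n p : nat) (Xi : (n + p).+2.-tuple R).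
Variables (P : 'I_n.+1 -> 'rV[R]_2) (w : 'I_n.+1 -> R) (s t : R).
Hypothesis s_gt0 : 0 < s.

Lemma bspline_affine_knots (i : 'I_n.+1) (x : R) :
  bspline (affine_knots s t Xi) p i (s * x + t) = bspline Xi p i x.
Proof.
apply: bspline_affine => //.
by rewrite size_tuple addn1 !ltnS leq_add2r -ltnS ltn_ord.
Qed.

Lemma nurbs_denom_affine (x : R) :
  nurbs_denom (affine_knots s t Xi) w (s * x + t) = nurbs_denom Xi w x.
Proof. by apply: eq_bigr => j _; rewrite bspline_affine_knots. Qed.

Lemma nurbs_curve_affine (x : R) :
  nurbs_curve (affine_knots s t Xi) P w (s * x + t) = nurbs_curve Xi P w x.
Proof.
apply: eq_bigr => i _.
by rewrite /nurbs_basis bspline_affine_knots nurbs_denom_affine.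
Qed.

Lemma nurbs_domain_affine (x : R) :
  nurbs_domain (affine_knots s t Xi) w (s * x + t) <-> nurbs_domain Xi w x.
Proof.
rewrite /nurbs_domain /mkset nurbs_denom_affine !(nth_map 0) ?size_tuple //.
  by rewrite !ler_affine.
by rewrite addn1.
Qed.

End AffineReparametrization.

Theorem proposition3 (R : realType) (n p : nat) (Xi : (n + p).+2.-tuple R)
    (hXi : knot_vector Xi) (P : 'I_n.+1 -> 'rV[R]_2) (w : 'I_n.+1 -> R)
    (s t : R) (hs : 0 < s) :
  knot_vector (affine_knots s t Xi) /\
  (forall x : R, nurbs_domain Xi w x ->
     nurbs_domain (affine_knots s t Xi) w (s * x + t) /\
     nurbs_curve (affine_knots s t Xi) P w (s * x + t) = nurbs_curve Xi P w x)
  /\ nurbs_shape (affine_knots s t Xi) P w = nurbs_shape Xi P w.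
Proof.
split; first by rewrite /knot_vector (mono_sorted (ler_affine t hs)).
split.
  by move=> x dx; split; [exact/nurbs_domain_affine | exact: nurbs_curve_affine].
apply/seteqP; split=> [_ [y dy <-]|_ [x dx <-]].
  have yE : y = s * ((y - t) / s) + t.
    by rewrite mulrC divfK ?gt_eqF // subrK.
  exists ((y - t) / s); last by rewrite [in RHS]yE nurbs_curve_affine.
  by apply/(nurbs_domain_affine Xi w t hs); rewrite -yE.
exists (s * x + t); last exact: nurbs_curve_affine.
exact/nurbs_domain_affine.
Qed.
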